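(* Let $n,B\ge 1$ be integers, $\rho>0$, and let $\mathcal{Q}\subset\mathbb{R}^{nB}$ be a compact set such that $\|\mathbf{x}\|_\infty\le \rho/2$ for all $\mathbf{x}\in\mathcal{Q}$. Let $\mathcal{C}$ denote the codebook of a rate-$r$, distortion-$\delta$ lossy compression code $(f,g)$ for $\mathcal{Q}$. Let $p\in(0,1)$ and let $\mathbf{D}_i=\mathrm{diag}(D_{i1},\ldots,D_{in})$, $i=1,\ldots,B$, where $\{D_{ij}\}_{1\le i\le B,\,1\le j\le n}$ are i.i.d. $\mathrm{Bern}(p)$ random variables. For $\mathbf{x}\in\mathcal{Q}$ and $\mathbf{y}=\sum_{i=1}^B\mathbf{D}_i\mathbf{x}_i$, let $\hat{\mathbf{x}}$ be a solution of $$\hat{\mathbf{x}}=\arg\min_{\mathbf{c}\in\mathcal{C}}\Big\|\mathbf{y}-\sum_{i=1}^B\mathbf{D}_i\mathbf{c}_i\Big\|_2^2 .$$ Let $\epsilon>0$ be a free parameter. Then $$\frac{1}{nB}\|\mathbf{x}-\hat{\mathbf{x}}\|_2^2\le\Big(1+\frac{Bp}{1-p}\Big)\frac{\delta}{nB}+\frac{\rho^2\epsilon}{p-p^2}$$ with probability larger than $1-2^{Br+1}\exp\big(-\frac{n\epsilon^2}{2B^2}\big)$. Moreover, for fixed parameters $(n,B,\epsilon,\rho)$ (and fixed $\delta$), the right-hand side of this bound, as a function of $p\in(0,1)$, is minimized at some $p^*$ with $p^*<\frac12$.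
   Context: A vector $\mathbf{x}\in\mathbb{R}^{nB}$ is viewed as the concatenation of $B$ frames $\mathbf{x}_1,\ldots,\mathbf{x}_B\in\mathbb{R}^n$; similarly $\mathbf{c}\in\mathbb{R}^{nB}$ has frames $\mathbf{c}_1,\ldots,\mathbf{c}_B$. A lossy compression code of rate $r$ for $\mathcal{Q}$ is a pair of maps $f:\mathcal{Q}\to\{1,2,\ldots,2^{Br}\}$ (encoder) and $g:\{1,2,\ldots,2^{Br}\}\to\mathbb{R}^{nB}$ (decoder). Its distortion is $\delta=\sup_{\mathbf{x}\in\mathcal{Q}}\|\mathbf{x}-g(f(\mathbf{x}))\|_2^2$, and its codebook is $\mathcal{C}=\{g(f(\mathbf{x})):\mathbf{x}\in\mathcal{Q}\}$, so $|\mathcal{C}|\le 2^{Br}$. $\mathrm{Bern}(p)$ is the distribution on $\{0,1\}$ with probability $p$ of the value $1$. The probability is over the random masks $\mathbf{D}_1,\ldots,\mathbf{D}_B$, with $\mathbf{x}$ fixed.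
   Formalization: Two hypotheses are added because the claim fails without them: every codeword c satisfies ‖x−c‖_∞ ≤ ρ for all x in Q (e.g. codewords in [−ρ/2, ρ/2]), and δ > 0 for the final claim p* < 1/2 (for δ = 0 the minimizer is exactly 1/2). *)

(* Defs.v *)
From HB Require Import structures.
From mathcomp Require Import all_boot all_order all_algebra.
From mathcomp Require Import all_classical all_reals all_analysis.

Set Implicit Arguments.
Unset Strict Implicit.
Unset Printing Implicit Defensive.

Import Order.TTheory GRing.Theory Num.Theory.
Import numFieldNormedType.Exports.

Local Open Scope classical_set_scope.
Local Open Scope ring_scope.

Definition sqnorm2 (R : realType) (m : nat) (v : 'rV[R]_m) : R :=
  \sum_(j < m) v 0 j ^+ 2.

(* [vec_mx] cuts a vector of length B * n into B consecutive rows of length n. *)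
Definition frame (R : realType) (n B : nat) (x : 'rV[R]_(B * n)) (i : 'I_B) :
    'rV[R]_n :=
  row i (vec_mx x).

Definition mask_mx (R : realType) (n : nat) (d : 'I_n -> bool) : 'M[R]_n :=
  diag_mx (\row_j (d j)%:R).

(* Frames are row vectors, so D_i x_i becomes x_i *m D_i. *)
Definition snapshot (R : realType) (n B : nat) (d : 'I_B -> 'I_n -> bool)
    (x : 'rV[R]_(B * n)) : 'rV[R]_n :=
  \sum_(i < B) frame x i *m mask_mx R (d i).

(* Codeword indices are the natural numbers k with 1 <= k <= 2^(B r); the rate
   r is real and B r need not be an integer. Only the values of f on Q, and
   those of g on f(Q), are ever used. *)
Definition rate_code (R : realType) (n B : nat) (r : R)
    (Q : set 'rV[R]_(B * n)) (f : 'rV[R]_(B * n) -> nat) : Prop :=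
  forall x, Q x -> (1 <= f x)%N /\ (f x)%:R <= 2 `^ (B%:R * r).

Definition codebook (R : realType) (m : nat) (Q : set 'rV[R]_m)
    (f : 'rV[R]_m -> nat) (g : nat -> 'rV[R]_m) : set 'rV[R]_m :=
  [set g (f x) | x in Q].

(* The set is bounded above when Q is bounded and f takes finitely many values
   on Q, so the real-valued supremum is then the genuine one (Q nonempty). *)
Definition distortion (R : realType) (m : nat) (Q : set 'rV[R]_m)
    (f : 'rV[R]_m -> nat) (g : nat -> 'rV[R]_m) : R :=
  sup [set sqnorm2 (x - g (f x)) | x in Q].

Definition is_argmin (T : Type) (R : realType) (C : set T) (h : T -> R)
    (c : T) : Prop :=
  C c /\ forall c', C c' -> h c <= h c'.

Definition mutually_independent (d d' : measure_display)
    (T : measurableType d) (T' : measurableType d') (R : realType)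
    (P : probability T R) (I : finType) (X : I -> {RV P >-> T'}) : Prop :=
  forall (J : {set I}) (A : I -> set T'), (forall i, measurable (A i)) ->
    P (\bigcap_(i in [set` J]) (X i @^-1` A i)) =
    (\prod_(i in J) P (X i @^-1` A i))%E.

Definition iid_bernoulli (d : measure_display) (T : measurableType d)
    (R : realType) (P : probability T R) (n B : nat) (p : R)
    (D : 'I_B -> 'I_n -> {RV P >-> bool}) : Prop :=
  (forall i j, distribution P (D i j) =1 bernoulli_prob p) /\
  mutually_independent (fun ij : 'I_B * 'I_n => D ij.1 ij.2).

Definition recovery_bound (R : realType) (n B : nat)
    (rho eps delta p : R) : R :=
  (1 + B%:R * p / (1 - p)) * (delta / (n * B)%:R)
  + rho ^+ 2 * eps / (p - p ^+ 2).

(* Main.v *)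
Require Import Defs.
From HB Require Import structures.
From mathcomp Require Import all_boot all_order all_algebra.
From mathcomp Require Import all_classical all_reals all_analysis.
From mathcomp Require Import measurable_realfun ring lra.

(* Write u = x - g (f x), so that |u|^2 <= delta, and let A be the measurement
   map. For a fixed v the squared norm of A v is a sum of n independent terms
   in [0, B^2 rho^2], of mean
     (p - p^2) |v|^2 + p^2 |v_1 + ... + v_B|^2,
   which is at least (p - p^2) |v|^2 and at most (p - p^2 + B p^2) |v|^2.
   If the error bound fails for the selected codeword c, then the mean of
   |A (x - c)|^2 exceeds that of |A u|^2 by at least t = n B rho^2 eps, whereas
   minimality of c forces |A (x - c)|^2 <= |A u|^2. Hoeffding's inequality
   bounds the probability of this for a fixed c, and a union bound over the at
   most 2^(B r) codewords concludes; only the law of the mask matters, so all of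
   this is a finite computation with product weights.

   Up to a constant, the bound is s^2 / (1 - p) + t^2 / p with
   s^2 = B delta / (n B) + rho^2 eps and t^2 = rho^2 eps, which is minimal at
   p = t / (s + t), and t < s. *)

Set Implicit Arguments.
Unset Strict Implicit.
Unset Printing Implicit Defensive.

Import Order.TTheory GRing.Theory Num.Theory.
Import numFieldNormedType.Exports.

Local Open Scope classical_set_scope.
Local Open Scope ring_scope.

(** * Hoeffding's inequality for finite product weights *)

Lemma ge0_is_derive_ndecr (R : realType) (h h' : R -> R) :
  (forall x : R, 0 <= x -> is_derive x 1 h (h' x)) ->
  (forall x : R, 0 <= x -> 0 <= h' x) ->
  forall x : R, 0 <= x -> h 0 <= h x.
Proof.
move=> dh h'0 x x0.
apply: (@ger0_derive1_ndecr _ h 0 x) => //.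
- by move=> y /[!in_itv]/= /andP[/ltW y0 _]; have [] := dh y y0.
- move=> y /[!in_itv]/= /andP[/ltW y0 _].
  by have dhy := dh y y0; rewrite derive1E derive_val h'0.
- apply: derivable_within_continuous => y /[!in_itv]/= /andP[y0 _].
  by have [] := dh y y0.
Qed.

(** After taking logarithms, the difference [G] of the exponents vanishes at 0, and its derivative
    is nonnegative by [slope]. *)
Lemma bernoulli_mgf_le (R : realType) (q u : R) : 0 <= q <= 1 -> 0 <= u ->
  1 - q + q * expR u <= expR (q * u + u ^+ 2 / 8).
Proof.
move=> /andP[q0 q1] u0.
pose m (v : R) : R := 1 - q + q * expR v.
have m1 (v : R) : 0 <= v -> 1 <= m v.
  move=> v0; have ev : 1 <= expR v by rewrite -expR0 ler_expR.
  by rewrite /m; nra.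
have dm (v : R) : is_derive v 1 m (q * expR v).
  rewrite /m; apply: is_derive_eq => /=.
  by rewrite !add0r /GRing.scale /=; ring.
have m_gt0 (v : R) : 0 <= v -> 0 < m v.
  by move=> v0; rewrite (lt_le_trans _ (m1 v v0)).
(* Both sides agree at 0, and AM-GM bounds the derivative of the left one,
   [(1 - q) (q e^v) / (m v)^2], by 1/4. *)
have slope (v : R) : 0 <= v -> q * expR v / m v <= q + v / 4.
  move=> v0.
  pose F (y : R) := q + 4^-1 * y - 1 + (1 - q) * (m y)^-1.
  pose F' (y : R) : R := 4^-1 - (1 - q) * (q * expR y) / m y ^+ 2.
  have dF (y : R) : 0 <= y -> is_derive y 1 F (F' y).
    move=> y0.
    have ? := is_deriveV (lt0r_neq0 (m_gt0 y y0)) (dm y).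
    rewrite /F; apply: is_derive_eq => /=.
    rewrite /F' /GRing.scale /=; ring.
  have F'0 (y : R) : 0 <= y -> 0 <= F' y.
    move=> y0; rewrite /F' subr_ge0 ler_pdivrMr ?exprn_gt0 ?m_gt0 //.
    rewrite -subr_ge0.
    have -> : 4^-1 * m y ^+ 2 - (1 - q) * (q * expR y)
            = 4^-1 * (1 - q - q * expR y) ^+ 2 by rewrite /m; field.
    by rewrite mulr_ge0 ?sqr_ge0 // invr_ge0.
  have := ge0_is_derive_ndecr dF F'0 v0.
  have e0 : F 0 = 0 by rewrite /F /m expR0 mulr1 subrK invr1; ring.
  rewrite e0 /F.
  have -> : q * expR v / m v = 1 - (1 - q) * (m v)^-1.
    rewrite {1}(_ : q * expR v = m v - (1 - q)); last by rewrite /m; ring.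
    by rewrite mulrBl divff // lt0r_neq0 ?m_gt0.
  by move: (m v)^-1 => z; lra.
pose G (y : R) := q * y + 8^-1 * y ^+ 2 - ln (m y).
pose G' (y : R) := q + y / 4 - q * expR y / m y.
have dG (y : R) : 0 <= y -> is_derive y 1 G (G' y).
  move=> y0; have ? := is_derive1_ln (m_gt0 y y0).
  have ? := @is_derive1_comp R _ m y _ _ (is_derive1_ln (m_gt0 y y0)) (dm y).
  rewrite /G; apply: is_derive_eq => /=.
  by rewrite /G' /GRing.scale /=; field; exact: lt0r_neq0 (m_gt0 y y0).
have G'0 (y : R) : 0 <= y -> 0 <= G' y by move=> y0; rewrite subr_ge0 slope.
have := ge0_is_derive_ndecr dG G'0 u0.
have -> : G 0 = 0.
  by rewrite /G /m expR0 mulr1 subrK ln1 expr0n /= !mulr0 addr0 subrr.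
rewrite subr_ge0 -ler_expR lnK ?posrE ?m_gt0 //.
by rewrite mulrC [8^-1 * _]mulrC mulrC.
Qed.

Lemma expR_chord (R : realType) (t u : R) : 0 <= t <= 1 ->
  expR (t * u) <= 1 - t + t * expR u.
Proof.
move=> t01.
have := @convex_expR R (Itv01 (proj1 (andP t01)) (proj2 (andP t01))) u 0.
rewrite !convRE /= /unstable.onem expR0.
by rewrite mulr0 addr0 mulr1 addrC.
Qed.

(** Rescaling [X] to [0, 1] and bounding the exponential by its chord reduces the claim to a
    Bernoulli variable of the same mean [q], with exponent [u]. *)
Lemma hoeffding_lemma (R : realType) (I : finType) (w X : I -> R) (a b s : R) :
  (forall i, 0 <= w i) -> \sum_i w i = 1 ->
  a < b -> (forall i, a <= X i <= b) -> 0 <= s ->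
  \sum_i w i * expR (s * (X i - \sum_j w j * X j))
    <= expR (s ^+ 2 * (b - a) ^+ 2 / 8).
Proof.
move=> w0 w1 ab Xab s0.
have ba0 : 0 < b - a by rewrite subr_gt0.
have ba_neq0 := lt0r_neq0 ba0.
set mu := \sum_j w j * X j.
pose q := (mu - a) / (b - a); pose u := s * (b - a).
have q_sum : q = \sum_i w i * ((X i - a) / (b - a)).
  rewrite /q /mu -[X in _ - X]mulr1 -w1 mulr_sumr -sumrB mulr_suml.
  by apply: eq_bigr => i _; field.
have t01 i : 0 <= (X i - a) / (b - a) <= 1.
  have /andP[aX Xb] := Xab i.
  rewrite divr_ge0 ?subr_ge0 ?(ltW ab) //= ler_pdivrMr // mul1r.
  by rewrite lerD2r.
have q01 : 0 <= q <= 1.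
  rewrite q_sum sumr_ge0 /= => [|i _]; last first.
    by rewrite mulr_ge0 //; case/andP: (t01 i).
  rewrite -w1; apply: ler_sum => i _; rewrite ler_piMr //.
  by case/andP: (t01 i).
have u0 : 0 <= u by rewrite mulr_ge0 // ltW.
apply: (@le_trans _ _ (expR (- (q * u)) * (1 - q + q * expR u))).
  have -> : 1 - q + q * expR u
          = \sum_i w i * (1 - (X i - a) / (b - a)
                          + (X i - a) / (b - a) * expR u).
    rewrite -{1}w1 q_sum mulr_suml -sumrB -big_split /=.
    by apply: eq_bigr => i _; ring.
  rewrite mulr_sumr; apply: ler_sum => i _.
  rewrite mulrCA ler_wpM2l //.
  have -> : s * (X i - mu) = - (q * u) + (X i - a) / (b - a) * u.
    by rewrite /q /u; field.
  by rewrite expRD ler_wpM2l ?expR_ge0 // expR_chord.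
apply: (@le_trans _ _ (expR (- (q * u)) * expR (q * u + u ^+ 2 / 8))).
  by rewrite ler_wpM2l ?expR_ge0 // bernoulli_mgf_le.
by rewrite -expRD addKr exprMn.
Qed.

(** Chernoff's method: on the event, exp(s (sum - t)) is at least 1, and its expectation factors
    over [I] because the weights are products. *)
Lemma hoeffding_tail (R : realType) (I J : finType) (w : J -> R)
    (X : I -> J -> R) (a b t : R) :
  (0 < #|I|)%N -> (forall j, 0 <= w j) -> \sum_j w j = 1 ->
  a < b -> (forall i j, a <= X i j <= b) -> 0 <= t ->
  \sum_(h : {ffun I -> J} |
        t <= \sum_i (X i (h i) - \sum_j w j * X i j)) \prod_i w (h i)
    <= expR (- (2 * t ^+ 2 / (#|I|%:R * (b - a) ^+ 2))).
Proof.
move=> I0 w0 w1 ab Xab t0.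
have ba_neq0 : b - a != 0 by rewrite subr_eq0 gt_eqF.
have I_neq0 : #|I|%:R != 0 :> R by rewrite pnatr_eq0 -lt0n.
(* This minimizes - s t + #|I| s^2 (b - a)^2 / 8, the exponent reached at the end. *)
pose s := 4 * t / (#|I|%:R * (b - a) ^+ 2).
have s0 : 0 <= s.
  by apply: divr_ge0; apply: mulr_ge0; rewrite ?ler0n ?sqr_ge0.
pose Y i j := X i j - \sum_k w k * X i k.
have prodw_ge0 (h : {ffun I -> J}) : 0 <= \prod_i w (h i).
  by rewrite prodr_ge0.
apply: (@le_trans _ _ (\sum_(h : {ffun I -> J})
    expR (- (s * t)) * \prod_i (w (h i) * expR (s * Y i (h i))))).
  rewrite [leLHS]big_mkcond /=; apply: ler_sum => h _.
  rewrite [X in _ * X]big_split /= -expR_sum -mulr_sumr.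
  case: ifPn => [tY|_]; last by rewrite !mulr_ge0 ?expR_ge0.
  rewrite mulrCA -expRD ler_peMr // -expR0 ler_expR addrC subr_ge0.
  by rewrite ler_wpM2l.
rewrite -mulr_sumr -(bigA_distr_bigA (fun i j => w j * expR (s * Y i j))).
apply: (@le_trans _ _ (expR (- (s * t)) *
                       \prod_(i : I) expR (s ^+ 2 * (b - a) ^+ 2 / 8))).
  rewrite ler_wpM2l ?expR_ge0 //; apply: ler_prod => i _; apply/andP; split.
    by rewrite sumr_ge0 // => j _; rewrite mulr_ge0 ?expR_ge0.
  exact: hoeffding_lemma.
rewrite -expR_sum -expRD ler_expR sumr_const -mulr_natl.
rewrite le_eqVlt; apply/orP; left; apply/eqP.
by rewrite /s; field; rewrite I_neq0 ba_neq0.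
Qed.

(** * Moments of a random mask *)

(** Later [I] is the set of frames: this is the law of the B mask entries at one coordinate, the
    only ones that this coordinate of the snapshot sees. *)
Definition mask_prob (R : realType) (I : finType) (p : R)
    (d : {ffun I -> bool}) : R := \prod_i bernoulli_pmf p (d i).

Lemma mask_prob_ge0 (R : realType) (I : finType) (p : R)
    (d : {ffun I -> bool}) :
  0 < p < 1 -> 0 <= mask_prob p d.
Proof.
move=> /andP[/ltW p0 /ltW p1]; apply: prodr_ge0 => i _.
by rewrite bernoulli_pmf_ge0 // p0.
Qed.

(** The sum over masks factors entrywise. The empty [S] gives the total mass, and a set {i, k} gives
    the second moments. *)
Lemma sum_mask_prob_prod (R : realType) (I : finType) (p : R) (S : {set I}) :
  \sum_(d : {ffun I -> bool}) mask_prob p d * \prod_(l in S) (d l)%:R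
    = p ^+ #|S|.
Proof.
pose F (l : I) (b : bool) :=
  bernoulli_pmf p b * (if l \in S then b%:R else 1).
under eq_bigr do rewrite [X in _ * X]big_mkcond -big_split /=.
rewrite -(bigA_distr_bigA F) /F -prodr_const [RHS]big_mkcond.
apply: eq_bigr => l _; rewrite big_bool /=.
by case: ifP => _; rewrite ?mulr1 ?mulr0 ?addr0 // subrKC.
Qed.

Lemma sum_mask_prob (R : realType) (I : finType) (p : R) :
  \sum_(d : {ffun I -> bool}) mask_prob p d = 1.
Proof.
rewrite -[RHS](expr0 p) -(cards0 I) -(sum_mask_prob_prod p).
by apply: eq_bigr => d _; rewrite big_set0 mulr1.
Qed.

Lemma sum_mask_prob_sqr (R : realType) (I : finType) (p : R) (v : I -> R) :
  \sum_(d : {ffun I -> bool}) mask_prob p d * (\sum_i (d i)%:R * v i) ^+ 2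
    = (p - p ^+ 2) * (\sum_i v i ^+ 2) + p ^+ 2 * (\sum_i v i) ^+ 2.
Proof.
pose W i k : R := \sum_(d : {ffun I -> bool})
  mask_prob p d * ((d i)%:R * (d k)%:R).
have WE i k : W i k = if i == k then p else p ^+ 2.
  (* The exponent is the cardinality of {i, k}, in the form used by [cards2]. *)
  have <- : p ^+ (i != k).+1 = if i == k then p else p ^+ 2 by case: eqP.
  rewrite -cards2 -sum_mask_prob_prod; apply: eq_bigr => d _; congr (_ * _).
  have [->|ik] := eqVneq i k.
    by rewrite finset.setUid big_set1; case: (d k); rewrite ?mulr1 ?mulr0.
  by rewrite big_setU1 ?inE //= big_set1.
have sqrE (u : I -> R) : (\sum_i u i) ^+ 2 = \sum_i \sum_k u i * u k.
  by rewrite expr2 mulr_suml; apply: eq_bigr => i _; rewrite mulr_sumr.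
transitivity (\sum_i \sum_k v i * v k * W i k).
  under eq_bigr do rewrite sqrE mulr_sumr.
  rewrite exchange_big /=; apply: eq_bigr => i _.
  under eq_bigr do rewrite mulr_sumr.
  rewrite exchange_big /=; apply: eq_bigr => k _.
  by rewrite mulr_sumr; apply: eq_bigr => d _; ring.
rewrite sqrE !mulr_sumr -big_split /=; apply: eq_bigr => i _.
rewrite mulr_sumr [in RHS](bigD1 i) //= (bigD1 i) //= WE eqxx addrA.
congr (_ + _); first by ring.
by apply: eq_bigr => k /negPf ki; rewrite WE eq_sym ki mulrC.
Qed.

(** Sum v_i v_k <= (v_i^2 + v_k^2) / 2 over all pairs. *)
Lemma sqr_sum_le (R : realType) (I : finType) (v : I -> R) :
  (\sum_i v i) ^+ 2 <= #|I|%:R * \sum_i v i ^+ 2.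
Proof.
have -> : #|I|%:R * \sum_i v i ^+ 2
        = \sum_i \sum_k (v i ^+ 2 + v k ^+ 2) / 2.
  rewrite [RHS](eq_bigr (fun i =>
      (v i ^+ 2 *+ #|I| + \sum_k v k ^+ 2) / 2)); last first.
    by move=> i _; rewrite -mulr_suml big_split /= sumr_const.
  rewrite -mulr_suml big_split /= sumr_const sumrMnl -mulr_natl.
  by field.
rewrite expr2 mulr_suml; apply: ler_sum => i _.
rewrite mulr_sumr; apply: ler_sum => k _.
by rewrite ler_pdivlMr //; have := sqr_ge0 (v i - v k); rewrite sqrrB; lra.
Qed.

(** * Measurements coordinate by coordinate, and their concentration *)

Lemma sqnorm2_vec_mx (R : realType) (n B : nat) (v : 'rV[R]_(B * n)) :
  sqnorm2 v = \sum_j \sum_i vec_mx v i j ^+ 2.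
Proof.
rewrite exchange_big pair_big /= /sqnorm2 (reindex _ (curry_mxvec_bij B n)) /=.
by apply: eq_bigr => -[i j] _; rewrite -{1}(vec_mxK v) mxvecE.
Qed.

Lemma snapshotE (R : realType) (n B : nat) (m : 'I_B -> 'I_n -> bool)
    (v : 'rV[R]_(B * n)) (j : 'I_n) :
  snapshot m v 0 j = \sum_i (m i j)%:R * vec_mx v i j.
Proof.
rewrite /snapshot summxE; apply: eq_bigr => i _.
by rewrite /frame /mask_mx mul_mx_diag !mxE mulrC.
Qed.

Lemma sqnorm2_snapshotB (R : realType) (n B : nat) (m : 'I_B -> 'I_n -> bool)
    (x c : 'rV[R]_(B * n)) :
  sqnorm2 (snapshot m x - snapshot m c)
    = \sum_j (\sum_i (m i j)%:R * vec_mx (x - c) i j) ^+ 2.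
Proof.
apply: eq_bigr => j _; rewrite !mxE !snapshotE -sumrB; congr (_ ^+ 2).
by apply: eq_bigr => i _; rewrite linearB !mxE mulrBr.
Qed.

Lemma coord_norm_le (R : realType) (m n : nat) (A : 'M[R]_(m, n)) i j :
  `|A i j| <= `|A|.
Proof.
rewrite [leRHS]mx_normrE.
exact: (le_bigmax 0 (fun ij : 'I_m * 'I_n => `|A ij.1 ij.2|) (i, j)).
Qed.

(** The norm of [v] is the sup norm, so each of the B summands is at most rho in absolute value. *)
Lemma mask_sqr_le (R : realType) (n B : nat) (rho : R) (v : 'rV[R]_(B * n))
    (d : 'I_B -> bool) (j : 'I_n) : `|v| <= rho ->
  (\sum_i (d i)%:R * vec_mx v i j) ^+ 2 <= B%:R ^+ 2 * rho ^+ 2.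
Proof.
move=> v_rho; rewrite -exprMn -real_normK ?num_real //.
rewrite ler_pXn2r ?nnegrE ?mulr_ge0 ?ler0n ?(le_trans _ v_rho) //.
rewrite (le_trans (ler_norm_sum _ _ _)) //.
have -> : B%:R * rho = \sum_(i < B) rho.
  by rewrite sumr_const card_ord mulr_natl.
apply: ler_sum => i _; rewrite normrM.
apply: (@le_trans _ _ `|vec_mx v i j|).
  by case: (d i); rewrite ?normr1 ?mul1r // normr0 mul0r.
by rewrite mxE (le_trans (coord_norm_le _ _ _)).
Qed.

(* Comparing the two measurements in one sum doubles both the width of the
   terms and the deviation, so that a single one-sided Hoeffding bound replaces
   the lower tail for [v] and the upper tail for [u]. *)
Lemma mask_confusion_tail (R : realType) (n B : nat) (rho eps p : R)
    (u v : 'rV[R]_(B * n)) :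
  (0 < n)%N -> (0 < B)%N -> 0 < rho -> 0 < eps -> 0 < p < 1 ->
  `|u| <= rho -> `|v| <= rho ->
  (p - p ^+ 2 + B%:R * p ^+ 2) * sqnorm2 u + rho ^+ 2 * eps * (n * B)%:R
    <= (p - p ^+ 2) * sqnorm2 v ->
  \sum_(h : {ffun 'I_n -> {ffun 'I_B -> bool}} |
      \sum_j (\sum_i (h j i)%:R * vec_mx v i j) ^+ 2
        <= \sum_j (\sum_i (h j i)%:R * vec_mx u i j) ^+ 2)
    \prod_j mask_prob p (h j)
  <= expR (- (n%:R * eps ^+ 2 / (2 * B%:R ^+ 2))).
Proof.
move=> n0 B0 rho0 eps0 p01 u_rho v_rho gap.
pose Z w (j : 'I_n) (d : {ffun 'I_B -> bool}) : R :=
  (\sum_i (d i)%:R * vec_mx w i j) ^+ 2.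
pose X j d := Z u j d - Z v j d.
pose M := B%:R ^+ 2 * rho ^+ 2.
have B_gt0 : 0 < B%:R :> R by rewrite ltr0n.
have n_gt0 : 0 < n%:R :> R by rewrite ltr0n.
have M0 : 0 < M by rewrite mulr_gt0 ?exprn_gt0.
have ZM w j d : `|w| <= rho -> 0 <= Z w j d <= M.
  by move=> w_rho; rewrite sqr_ge0 mask_sqr_le.
have XM j d : - M <= X j d <= M.
  by have := ZM u j d u_rho; have := ZM v j d v_rho; rewrite /X; lra.
have MM : - M < M by lra.
pose t := rho ^+ 2 * eps * (n * B)%:R.
have t0 : 0 <= t by rewrite mulr_ge0 ?ler0n // mulr_ge0 ?sqr_ge0 // ltW.
have EZ w j : \sum_d mask_prob p d * Z w j d
    = (p - p ^+ 2) * (\sum_i vec_mx w i j ^+ 2)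
      + p ^+ 2 * (\sum_i vec_mx w i j) ^+ 2.
  exact: sum_mask_prob_sqr.
(* For [u] the squared frame sum is bounded by Cauchy-Schwarz, which produces the factor B; for [v]
   it is nonnegative and dropped. *)
have EX : \sum_j \sum_d mask_prob p d * X j d <= - t.
  apply: (@le_trans _ _ ((p - p ^+ 2 + B%:R * p ^+ 2) * sqnorm2 u
                         - (p - p ^+ 2) * sqnorm2 v)); last first.
    by rewrite /t; move: gap; lra.
  rewrite !sqnorm2_vec_mx !mulr_sumr -sumrB; apply: ler_sum => j _.
  rewrite (eq_bigr (fun d =>
      mask_prob p d * Z u j d - mask_prob p d * Z v j d)); last first.
    by move=> d _; rewrite /X mulrBr.
  rewrite sumrB !EZ.
  have := sqr_sum_le (fun i => vec_mx u i j); rewrite card_ord => /=.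
  move=> /(ler_wpM2l (sqr_ge0 p)).
  have : 0 <= p ^+ 2 * (\sum_i vec_mx v i j) ^+ 2 by rewrite mulr_ge0 ?sqr_ge0.
  by lra.
(* On the event the sum of the [X] is nonnegative while its mean is at most - t, so it exceeds its
   mean by t. *)
apply: (@le_trans _ _ (\sum_(h : {ffun 'I_n -> {ffun 'I_B -> bool}} |
    t <= \sum_j (X j (h j) - \sum_d mask_prob p d * X j d))
    \prod_j mask_prob p (h j))).
  rewrite [leLHS]big_mkcond [leRHS]big_mkcond /=; apply: ler_sum => h _.
  have w0 : 0 <= \prod_j mask_prob p (h j).
    by rewrite prodr_ge0 // => j _; exact: mask_prob_ge0.
  case: ifPn => [vu|_]; last by case: ifP.
  have X_ge0 : 0 <= \sum_j X j (h j) by rewrite sumrB subr_ge0.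
  by rewrite ifT // [leRHS]sumrB; lra.
have := @hoeffding_tail R _ _ (mask_prob p) X (- M) M t.
rewrite card_ord => /(_ n0) ht; apply: (le_trans (ht _ _ _ _ _)) => //.
- by move=> d; exact: mask_prob_ge0.
- exact: sum_mask_prob.
(* With width 2 M, the exponent 2 t^2 / (n (2 M)^2) is n eps^2 / (2 B^2). *)
rewrite ler_expR le_eqVlt; apply/orP; left; apply/eqP.
have -> : M - - M = 2 * M by ring.
by rewrite /t /M natrM; field; rewrite !lt0r_neq0.
Qed.

(** * The error bound as a function of p *)

(** Clearing denominators turns the error bound into the gap required by [mask_confusion_tail], with
    [delta] in place of the squared norm of [u]. *)
Lemma recovery_boundE (R : realType) (n B : nat) (rho eps delta p : R) :
  (0 < n)%N -> (0 < B)%N -> 0 < p < 1 ->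
  recovery_bound n B rho eps delta p * ((p - p ^+ 2) * (n * B)%:R)
    = (p - p ^+ 2 + B%:R * p ^+ 2) * delta + rho ^+ 2 * eps * (n * B)%:R.
Proof.
move=> n0 B0 /andP[p0 p1].
have p_neq0 : p != 0 by rewrite lt0r_neq0.
have p'_neq0 : 1 - p != 0 by rewrite subr_eq0 gt_eqF.
rewrite /recovery_bound (_ : p - p ^+ 2 = p * (1 - p)); last by ring.
by field; rewrite p_neq0 p'_neq0 !pnatr_eq0 -!lt0n n0 B0.
Qed.

Lemma recovery_bound_minimizer (R : realType) (n B : nat) (rho eps delta : R) :
  (0 < n)%N -> (0 < B)%N -> 0 < rho -> 0 < eps -> 0 < delta ->
  exists pstar : R, [/\ 0 < pstar < 1, pstar < 1 / 2 &
    forall p : R, 0 < p < 1 ->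
      recovery_bound n B rho eps delta pstar
      <= recovery_bound n B rho eps delta p].
Proof.
move=> n0 B0 rho0 eps0 delta0.
pose a := delta / (n * B)%:R; pose b := rho ^+ 2 * eps.
have a0 : 0 < a by rewrite divr_gt0 // ltr0n muln_gt0 n0.
have b0 : 0 < b by rewrite mulr_gt0 ?exprn_gt0.
have B_gt0 : 0 < B%:R :> R by rewrite ltr0n.
have Ba0 : 0 < B%:R * a by rewrite mulr_gt0.
pose s := Num.sqrt (B%:R * a + b); pose t := Num.sqrt b.
have s2 : s ^+ 2 = B%:R * a + b by rewrite sqr_sqrtr // addr_ge0 ?ltW.
have t2 : t ^+ 2 = b by rewrite sqr_sqrtr // ltW.
have t0 : 0 < t by rewrite sqrtr_gt0.
have ts : t < s by rewrite ltr_sqrt ?addr_gt0 // ltrDr.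
have s0 : 0 < s := lt_trans t0 ts.
(* Partial fractions: p / (1 - p) = 1 / (1 - p) - 1 and 1 / (p - p^2) = 1 / p + 1 / (1 - p). *)
have boundE p : 0 < p < 1 -> recovery_bound n B rho eps delta p
    = a * (1 - B%:R) + (s ^+ 2 / (1 - p) + t ^+ 2 / p).
  move=> /andP[p0 p1]; rewrite s2 t2 /recovery_bound -/a -/b.
  have p_neq0 : p != 0 by rewrite lt0r_neq0.
  have p'_neq0 : 1 - p != 0 by rewrite subr_eq0 gt_eqF.
  rewrite (_ : p - p ^+ 2 = p * (1 - p)); last by ring.
  by field; rewrite p_neq0 p'_neq0.
have st0 : 0 < s + t by rewrite addr_gt0.
have star01 : 0 < t / (s + t) < 1.
  by rewrite divr_gt0 //= ltr_pdivrMr // mul1r ltrDr.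
exists (t / (s + t)); split => // [|p p01].
  by rewrite ltr_pdivrMr //; lra.
rewrite !boundE // lerD2l.
have -> : s ^+ 2 / (1 - t / (s + t)) + t ^+ 2 / (t / (s + t)) = (s + t) ^+ 2.
  rewrite (_ : 1 - t / (s + t) = s / (s + t)); last first.
    by field; exact: lt0r_neq0.
  by field; rewrite !lt0r_neq0.
have /andP[p0 p1] := p01.
have p'0 : 0 < 1 - p by rewrite subr_gt0.
rewrite -subr_ge0.
(* The excess over the value at the minimizer is a perfect square over p (1 - p). *)
have -> : s ^+ 2 / (1 - p) + t ^+ 2 / p - (s + t) ^+ 2
        = (s * p - t * (1 - p)) ^+ 2 / (p * (1 - p)).
  by field; rewrite !lt0r_neq0.
by rewrite divr_ge0 ?sqr_ge0 // mulr_ge0 // ltW.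
Qed.

(** * From the probability space to finite weights *)

(** The intersection has the shape required by [mutually_independent]. The pattern [h] takes the
    coordinate first, whereas [D] takes the frame first. *)
Definition mask_event (d : measure_display) (T : measurableType d)
    (R : realType) (P : probability T R) (n B : nat)
    (D : 'I_B -> 'I_n -> {RV P >-> bool})
    (h : {ffun 'I_n -> {ffun 'I_B -> bool}}) : set T :=
  \bigcap_(ij in [set` [set: 'I_B * 'I_n]%SET])
    D ij.1 ij.2 @^-1` [set h ij.2 ij.1].

Lemma mask_event_measurable (d : measure_display) (T : measurableType d)
    (R : realType) (P : probability T R) (n B : nat)
    (D : 'I_B -> 'I_n -> {RV P >-> bool}) h : measurable (mask_event D h).
Proof.
apply: fin_bigcap_measurable => // ij _.
exact: measurable_funPTI.
Qed.

Lemma mask_event_prob (d : measure_display) (T : measurableType d)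
    (R : realType) (P : probability T R) (n B : nat) (p : R)
    (D : 'I_B -> 'I_n -> {RV P >-> bool}) h :
  0 < p < 1 -> iid_bernoulli p D ->
  P (mask_event D h) = (\prod_j mask_prob p (h j))%:E.
Proof.
move=> p01 [Dp Dind].
rewrite (Dind _ (fun ij => [set h ij.2 ij.1])) //.
have one ij : P (D ij.1 ij.2 @^-1` [set h ij.2 ij.1])
    = (bernoulli_pmf p (h ij.2 ij.1))%:E.
  rewrite -[LHS]/(distribution P (D ij.1 ij.2) [set h ij.2 ij.1]) Dp.
  have /andP[/ltW p0 /ltW p1] := p01.
  rewrite bernoulli_probE ?p0 // !diracE /bernoulli_pmf.
  have memE (b b' : bool) : (b \in [set b']) = (b == b').
    by apply/idP/eqP; rewrite inE.
  by rewrite !memE; case: (h _ _); rewrite /= ?mule1 ?mule0 ?adde0 ?add0e.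
rewrite (eq_bigr _ (fun ij _ => one ij)) prodEFin; congr (_%:E).
rewrite (eq_bigl xpredT); last by move=> ij; rewrite finset.in_setT.
by rewrite /mask_prob exchange_big pair_big.
Qed.

(** The cells of the bad patterns cover [A], so finite subadditivity applies. Inclusion is enough:
    [A] may depend on more than the mask, as [xhat] may. *)
Lemma prob_mask_le (d : measure_display) (T : measurableType d)
    (R : realType) (P : probability T R) (n B : nat) (p : R)
    (D : 'I_B -> 'I_n -> {RV P >-> bool})
    (bad : pred {ffun 'I_n -> {ffun 'I_B -> bool}}) (A : set T) :
  0 < p < 1 -> iid_bernoulli p D -> measurable A ->
  (forall w, A w -> bad [ffun j => [ffun i => D i j w]]) ->
  (P A <= (\sum_(h | bad h) \prod_j mask_prob p (h j))%:E)%E.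
Proof.
move=> p01 HD mA Abad.
have := @content_sub_fsum _ _ _ P _ [set` enum bad] A (mask_event D)
  (finite_seq _)  (fun h _ => mask_event_measurable D h) mA.
rewrite -fsbig_seq ?enum_uniq // big_enum /= -sumEFin.
rewrite (eq_bigr _ (fun h _ => mask_event_prob h p01 HD)).
apply => w Aw; exists [ffun j => [ffun i => D i j w]] => /=.
  by rewrite mem_enum; exact: Abad.
by move=> [i j] _ /=; rewrite !ffunE.
Qed.

(** * Distortion and indexing of the codebook *)

Lemma sqnorm2_le (R : realType) (m : nat) (v : 'rV[R]_m) (rho : R) :
  `|v| <= rho -> sqnorm2 v <= m%:R * rho ^+ 2.
Proof.
move=> v_rho; rewrite mulr_natl -{2}(card_ord m) -sumr_const.
apply: ler_sum => j _; rewrite -real_normK ?num_real //.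
rewrite ler_pXn2r ?nnegrE ?(le_trans _ v_rho) //.
exact: coord_norm_le.
Qed.

(** The crude bound m rho^2 makes the set of squared errors bounded above, so that [sup] dominates
    its elements. *)
Lemma distortion_ge (R : realType) (m : nat) (Q : set 'rV[R]_m)
    (f : 'rV[R]_m -> nat) (g : nat -> 'rV[R]_m) (rho : R) (x : 'rV[R]_m) :
  (forall x c, Q x -> codebook Q f g c -> `|x - c| <= rho) -> Q x ->
  sqnorm2 (x - g (f x)) <= distortion Q f g.
Proof.
move=> Qrho Qx; apply: ub_le_sup; last by exists x.
exists (m%:R * rho ^+ 2) => _ [y Qy <-]; apply: sqnorm2_le.
by apply: Qrho => //; exists y.
Qed.

(** This provides the finite index type of the union bound. Code indices start at 1 and ordinals at
    0, hence the shift. *)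
Lemma codebook_index (R : realType) (n B : nat) (r : R)
    (Q : set 'rV[R]_(B * n)) (f : 'rV[R]_(B * n) -> nat)
    (g : nat -> 'rV[R]_(B * n)) (c : 'rV[R]_(B * n)) :
  rate_code r Q f -> codebook Q f g c ->
  exists k : 'I_(Num.truncn (2 `^ (B%:R * r))), c = g k.+1.
Proof.
move=> Qf [y Qy <-]; have [f1 fr] := Qf y Qy.
have fN : ((f y).-1 < Num.truncn (2 `^ (B%:R * r)))%N.
  by rewrite prednK // truncn_ge_nat ?powR_ge0.
by exists (Ordinal fN); rewrite /= prednK.
Qed.

Unset Implicit Arguments.
Set Strict Implicit.

Theorem theorem1 (R : realType) (n B : nat) (hn : (1 <= n)%N) (hB : (1 <= B)%N)
  (rho : R) (hrho : 0 < rho)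
  (Q : set 'rV[R]_(B * n)) (hQ : compact Q)
  (hQrho : forall x, Q x -> `|x| <= rho / 2)
  (r delta : R) (f : 'rV[R]_(B * n) -> nat) (g : nat -> 'rV[R]_(B * n))
  (hrate : rate_code r Q f) (hdelta : distortion Q f g = delta)
  (hrange : forall x c, Q x -> codebook Q f g c -> `|x - c| <= rho)
  (eps : R) (heps : 0 < eps) :
  (forall (p : R), 0 < p < 1 ->
   forall (d : measure_display) (T : measurableType d) (P : probability T R)
     (D : 'I_B -> 'I_n -> {RV P >-> bool}), iid_bernoulli p D ->
   forall (x : 'rV[R]_(B * n)), Q x ->
   forall (xhat : T -> 'rV[R]_(B * n)),
     (forall k, measurable_fun setT (fun w => xhat w 0 k)) ->
     (forall w, let A := snapshot (fun i j => D i j w) in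
        is_argmin (codebook Q f g) (fun c => sqnorm2 (A x - A c)) (xhat w)) ->
   ((1 - 2 `^ (B%:R * r + 1)
         * expR (- (n%:R * eps ^+ 2 / (2 * B%:R ^+ 2))))%:E
    < P [set w | (sqnorm2 (x - xhat w) / (n * B)%:R
                  <= recovery_bound n B rho eps delta p)%R])%E) /\
  (0 < delta ->
   exists pstar : R, [/\ 0 < pstar < 1, pstar < 1 / 2 &
     forall p : R, 0 < p < 1 ->
       recovery_bound n B rho eps delta pstar
       <= recovery_bound n B rho eps delta p]).
Proof.
split; last exact: recovery_bound_minimizer.
move=> p p01 d T P D HD x Qx xhat mxhat argmin_xhat.
have /andP[p0 p1] := p01.
pose N := Num.truncn (2 `^ (B%:R * r)).
pose e := expR (- (n%:R * eps ^+ 2 / (2 * B%:R ^+ 2))).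
pose xt := g (f x).
pose t := rho ^+ 2 * eps * (n * B)%:R.
have Cxt : codebook Q f g xt by exists x.
have pp0 : 0 < p - p ^+ 2.
  by rewrite expr2 -{1}[p]mulr1 -mulrBr mulr_gt0 // subr_gt0.
have nB0 : 0 < (n * B)%:R :> R by rewrite ltr0n muln_gt0 hn.
(* [far] is independent of the mask; [bad] adds that the pattern makes the far codeword fit at least
   as well as [xt]. *)
pose far (c : 'rV[R]_(B * n)) :=
  codebook Q f g c /\ (p - p ^+ 2 + B%:R * p ^+ 2) * sqnorm2 (x - xt) + t
                      <= (p - p ^+ 2) * sqnorm2 (x - c).
pose bad (k : 'I_N) (h : {ffun 'I_n -> {ffun 'I_B -> bool}}) :=
  `[< far (g k.+1) >] &&
  (\sum_j (\sum_i (h j i)%:R * vec_mx (x - g k.+1) i j) ^+ 2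
     <= \sum_j (\sum_i (h j i)%:R * vec_mx (x - xt) i j) ^+ 2).
set E := [set w | _].
have mE : measurable E.
  rewrite -[E]setTI; apply: measurable_fun_le => //.
  apply: measurable_funM => //; apply: measurable_sum => k.
  apply: measurable_funX; rewrite /=.
  under eq_fun do rewrite !mxE.
  exact: measurable_funB.
have weight_ge0 (h : {ffun 'I_n -> {ffun 'I_B -> bool}}) :
    0 <= \prod_j mask_prob p (h j).
  by rewrite prodr_ge0 // => j _; exact: mask_prob_ge0.
have bad_le k : \sum_(h | bad k h) \prod_j mask_prob p (h j) <= e.
  have [[Cg gap]|nfar] := pselect (far (g k.+1)).
    rewrite (eq_bigl (fun h : {ffun 'I_n -> {ffun 'I_B -> bool}} =>
      \sum_j (\sum_i (h j i)%:R * vec_mx (x - g k.+1) i j) ^+ 2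
        <= \sum_j (\sum_i (h j i)%:R * vec_mx (x - xt) i j) ^+ 2)); last first.
      by move=> h; rewrite /bad asboolT.
    by apply: (mask_confusion_tail (rho := rho)) => //; exact: hrange.
  by rewrite big_pred0 ?expR_ge0 // => h; rewrite /bad asboolF.
have sum_bad : \sum_(h | [exists k, bad k h]) \prod_j mask_prob p (h j)
    <= N%:R * e.
  apply: (@le_trans _ _ (\sum_(k < N) \sum_(h | bad k h)
                           \prod_j mask_prob p (h j))); last first.
    rewrite mulr_natl -[N in leRHS]card_ord -sumr_const.
    by apply: ler_sum => k _; exact: bad_le.
  (* Union bound, pattern by pattern: the weight of a bad pattern occurs for at least one
     codeword. *)
  under [leRHS]eq_bigr do rewrite big_mkcond.
  rewrite exchange_big big_mkcond /=; apply: ler_sum => h _.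
  have terms_ge0 (k : 'I_N) :
      0 <= if bad k h then \prod_j mask_prob p (h j) else 0.
    by case: ifP.
  case: ifPn => [/existsP[k badk]|_]; last by rewrite sumr_ge0.
  by rewrite (bigD1 k) //= badk lerDl sumr_ge0.
have PE : (P (~` E) <= (N%:R * e)%:E)%E.
  apply: (@le_trans _ _ (\sum_(h | [exists k, bad k h])
                           \prod_j mask_prob p (h j))%:E); last first.
    by rewrite lee_fin.
  apply: (prob_mask_le p01 HD); first exact: measurableC.
  move=> w /negP; rewrite -ltNge ltr_pdivlMr // => Ew.
  have [Cxhat xhat_min] := argmin_xhat w.
  have [k xhatk] := codebook_index hrate Cxhat.
  apply/existsP; exists k; apply/andP; split.
    apply/asboolP; rewrite -xhatk; split => //.
    (* The distortion controls [xt]; the failed error bound, multiplied by p - p^2, then gives the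
       gap for [xhat w]. *)
    apply: (@le_trans _ _ ((p - p ^+ 2 + B%:R * p ^+ 2) * delta + t)).
      rewrite lerD2r ler_wpM2l -?hdelta ?(distortion_ge hrange) //.
      by rewrite addr_ge0 ?mulr_ge0 ?ler0n ?sqr_ge0 // ltW.
    rewrite /t -recovery_boundE // mulrCA.
    by rewrite ler_wpM2l ?ltW.
  rewrite -xhatk; move: (xhat_min _ Cxt); rewrite !sqnorm2_snapshotB.
  have maskE (v : 'rV[R]_(B * n)) :
      \sum_j (\sum_i
        ([ffun j => [ffun i => D i j w]] j i)%:R * vec_mx v i j) ^+ 2
    = \sum_j (\sum_i (D i j w)%:R * vec_mx v i j) ^+ 2.
    apply: eq_bigr => j _; congr (_ ^+ 2); apply: eq_bigr => i _.
    by rewrite !ffunE.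
  by rewrite !maskE.
(* Since N <= 2^(B r), the extra factor 2 makes the final inequality strict. *)
have powD : 2 `^ (B%:R * r + 1) = 2 * 2 `^ (B%:R * r) :> R.
  by rewrite powRD ?powRr1 1?mulrC // pnatr_eq0 implybT.
rewrite -(setCK E) probability_setC; last exact: measurableC.
apply: (@lt_le_trans _ _ (1%:E - (N%:R * e)%:E)%E); last exact: leeB.
rewrite -EFinB lte_fin ltrD2l ltrN2 -/e powD.
have e0 : 0 < e := expR_gt0 _.
have pow0 : 0 < 2 `^ (B%:R * r) :> R by rewrite powR_gt0.
rewrite ltr_pM2r // (@le_lt_trans _ _ (2 `^ (B%:R * r))) //.
  by rewrite truncn_le ltW.
by lra.
Qed.
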